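(* For Vertex Cover in the Late Accept model, the competitive ratio is $2$; that is, there is a strictly $2$-competitive online algorithm in this model, and for every real $c<2$ no online algorithm in this model is $c$-competitive.
   Context: Online Vertex Cover (vertex arrival). An input $\sigma$ is a finite simple undirected graph $G=(V,E)$ together with an ordering of its vertices. Vertices arrive one by one in this order; when a vertex arrives, all edges between it and previously arrived vertices are revealed. All online algorithms are deterministic: each decision depends only on the part of the input revealed so far. After each arrival has been processed, the set of currently accepted vertices must be a vertex cover of the graph revealed so far (every edge has at least one accepted endpoint). $\mathrm{ALG}(\sigma)$ is the number of accepted vertices at the end of the input, and $\mathrm{OPT}(\sigma)$ is the minimum cardinality of a vertex cover of $G$; the objective is minimization. Late Accept model: in each step the algorithm may accept the newly arrived vertex and/or any earlier vertices that are not yet accepted; acceptance is irrevocable, i.e., an accepted vertex can never be removed. An algorithm $\mathrm{ALG}$ is $c$-competitive if there is a constant $\alpha$ such that $\mathrm{ALG}(\sigma)\le c\,\mathrm{OPT}(\sigma)+\alpha$ for all inputs $\sigma$; it is strictly $c$-competitive if this holds with $\alpha=0$. By convention, ''the competitive ratio is $c$'' includes that the upper bound holds for the strict competitive ratio and the lower bound for the (non-strict) competitive ratio. *)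

(* Defs.v *)
From mathcomp Require Import all_boot all_order all_algebra.
From mathcomp Require Import reals.

Set Implicit Arguments.
Unset Strict Implicit.
Unset Printing Implicit Defensive.

Import Order.TTheory GRing.Theory Num.Theory.

Record sgraph := SGraph {
  vertex :> finType;
  edge : rel vertex;
  edge_sym : symmetric edge;
  edge_irr : irreflexive edge
}.

Definition vertex_cover (G : sgraph) (C : {set G}) : bool :=
  [forall u : G, forall v : G, edge u v ==> (u \in C) || (v \in C)].

(* [setT] is always a vertex cover, so the [arg min] is a true minimum. *)
Definition opt (G : sgraph) : nat :=
  #|[arg min_(C < [set: G] | vertex_cover C) #|C| ]|.

Record input := Input {
  graph : sgraph;
  arrivals : seq graph;
  arrivals_uniq : uniq arrivals;
  arrivals_full : forall v : graph, v \in arrivals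
}.

(* What an arrival reveals: the adjacency of the new vertex to each earlier
   one, listed by arrival position.  Vertices have no other identity for an
   algorithm than their position (counted from 0) in the order of arrival. *)
Definition arrival (sigma : input) (v : graph sigma) : seq bool :=
  [seq edge v u | u <- take (index v (arrivals sigma)) (arrivals sigma)].

Definition revealed (sigma : input) (t : nat) : seq (seq bool) :=
  [seq arrival v | v <- take t (arrivals sigma)].

(* [d h p] : in the step whose arrival completes the history [h], accept the
   vertex at position [p].  The past decisions are determined by [h]. *)
Definition strategy := seq (seq bool) -> nat -> bool.

(* The accepted set after [t] steps.  Acceptance is irrevocable; step [t] may
   add any vertex among the first [t], and accepting a vertex again has no
   effect. *)
Fixpoint accepted (d : strategy) (sigma : input) (t : nat)
    : {set graph sigma} :=
  if t is t'.+1 then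
    accepted d sigma t' :|:
      [set v in take t (arrivals sigma)
         | d (revealed sigma t) (index v (arrivals sigma))]
  else set0.

Definition feasible (d : strategy) : Prop :=
  forall (sigma : input) (t : nat), t <= size (arrivals sigma) ->
  forall u v : graph sigma,
    u \in take t (arrivals sigma) -> v \in take t (arrivals sigma) -> edge u v ->
    (u \in accepted d sigma t) || (v \in accepted d sigma t).

Record late_accept_algorithm := LateAcceptAlgorithm {
  decide :> strategy;
  decide_feasible : feasible decide
}.

Definition cost (A : late_accept_algorithm) (sigma : input) : nat :=
  #|accepted A sigma (size (arrivals sigma))|.

Local Open Scope ring_scope.

Definition competitive_with (R : realType) (A : late_accept_algorithm)
    (c alpha : R) : Prop :=
  forall sigma : input,
    (cost A sigma)%:R <= c * (opt (graph sigma))%:R + alpha.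

Definition competitive (R : realType) (A : late_accept_algorithm) (c : R)
    : Prop :=
  exists alpha : R, competitive_with A c alpha.

Definition strictly_competitive (R : realType) (A : late_accept_algorithm)
    (c : R) : Prop :=
  competitive_with A c 0.

(* Main.v *)
Require Import Defs.
From mathcomp Require Import all_boot all_order all_algebra.
From mathcomp Require Import reals.
From mathcomp Require Import zify lra.

(** For the upper bound, a new vertex with an unaccepted earlier neighbour is
    accepted together with one such neighbour.  The pairs accepted in this way
    form a matching, and every vertex cover contains a vertex of each of them.

    For the lower bound, the adversary presents disjoint paths on three
    vertices.  It first presents an edge, of which some endpoint has to be
    accepted.  The third vertex of the path is attached to the second one if
    the first one is accepted, and to the first one otherwise, so that the new
    edge forces another acceptance; the middle vertex alone covers the path. *)

Set Implicit Arguments.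
Unset Strict Implicit.
Unset Printing Implicit Defensive.

Import Order.TTheory GRing.Theory Num.Theory.

(** * Prefixes of the arrival order, and minimum vertex covers *)

Lemma take_rcons_index (T : eqType) (s : seq T) (t : nat) :
  uniq s -> t < size s ->
  exists2 x, take t.+1 s = rcons (take t s) x & index x s = t.
Proof.
case: s => [|x0 s'] //; set s := x0 :: s' => us ts.
by exists (nth x0 s t); [exact: take_nth | exact: index_uniq].
Qed.

Lemma opt_le (G : sgraph) (C : {set G}) : vertex_cover C -> opt G <= #|C|.
Proof.
move=> vcC; rewrite /opt; case: arg_minnP => [|D _ minD]; last exact: minD.
by apply/forallP => u; apply/forallP => v; rewrite !inE implybT.
Qed.

Lemma opt_cover (G : sgraph) :
  exists2 C : {set G}, vertex_cover C & #|C| = opt G.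
Proof.
rewrite /opt; case: arg_minnP => [|D vcD _]; last by exists D.
by apply/forallP => u; apply/forallP => v; rewrite !inE implybT.
Qed.

Lemma revealedS (sigma : input) (t : nat) (v : graph sigma) :
  take t.+1 (arrivals sigma) = rcons (take t (arrivals sigma)) v ->
  revealed sigma t.+1 = rcons (revealed sigma t) (arrival v).
Proof. by rewrite /revealed => ->; rewrite map_rcons. Qed.

Lemma mem_take_arrivals (sigma : input) (t : nat) (v : graph sigma) :
  (v \in take t (arrivals sigma)) = (index v (arrivals sigma) < t).
Proof. by rewrite in_take ?arrivals_full. Qed.

Lemma size_arrival (sigma : input) (v : graph sigma) :
  size (arrival v) = index v (arrivals sigma).
Proof. by rewrite size_map size_takel ?index_size. Qed.

Lemma nth_arrival (sigma : input) (u v : graph sigma) :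
  index u (arrivals sigma) < index v (arrivals sigma) ->
  nth false (arrival v) (index u (arrivals sigma)) = edge v u.
Proof.
move=> uv; rewrite (nth_map u) ?size_takel ?index_size //.
by rewrite nth_take // nth_index ?arrivals_full.
Qed.

(** * The matching algorithm *)

(** The newcomer has position [size row], as its row has one entry per earlier vertex; [S] holds the
    positions accepted so far. *)
Definition matching_step (S : seq nat) (row : seq bool) : seq nat :=
  if [seq p <- iota 0 (size row) | nth false row p && (p \notin S)] is p :: _
  then [:: p, size row & S] else S.

Definition matched (h : seq (seq bool)) : seq nat :=
  foldl matching_step [::] h.

Definition matching_strategy : strategy := fun h p => p \in matched h.

Variant matching_step_spec (S : seq nat) (row : seq bool) : seq nat -> Prop :=
| MatchNew p of p < size row & nth false row p & p \notin S :
    matching_step_spec S row [:: p, size row & S]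
| MatchNone of (forall p, p < size row -> nth false row p -> p \in S) :
    matching_step_spec S row S.

Lemma matching_stepP (S : seq nat) (row : seq bool) :
  matching_step_spec S row (matching_step S row).
Proof.
rewrite /matching_step; case E: [seq _ <- _ | _] => [|p s].
  apply: MatchNone => p ps rp; apply/negbNE/negP => pS.
  suff: p \in [::] by [].
  by rewrite -E mem_filter rp pS mem_iota.
have: p \in p :: s by rewrite mem_head.
by rewrite -E mem_filter mem_iota => /andP[/andP[rp pS] ps]; apply: MatchNew.
Qed.

Lemma sub_matched_rcons (h : seq (seq bool)) (row : seq bool) :
  {subset matched h <= matched (rcons h row)}.
Proof.
rewrite /matched foldl_rcons => p ph.
by case: matching_stepP => // q _ _ _; rewrite !inE ph !orbT.
Qed.

Section MatchingRun.

Variable sigma : input.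
Let s := arrivals sigma.

Lemma index_arrivals_inj : injective (fun v : graph sigma => index v s).
Proof. by move=> u v; apply: (index_inj u); exact: arrivals_full. Qed.

(** Each step adds only the newcomer's position and a smaller one. Hence no vertex is selected
    before it arrives, and restricting a step to arrived vertices discards nothing. *)
Lemma matched_lt (t p : nat) :
  t <= size s -> p \in matched (revealed sigma t) -> p < t.
Proof.
elim: t p => [|t IH] p ts; first by rewrite /revealed take0.
have [v tv iv] := take_rcons_index (arrivals_uniq sigma) ts.
rewrite (revealedS tv) /matched foldl_rcons.
case: matching_stepP => [q|_ /IH]; last by lia.
rewrite size_arrival iv => qt _ _; rewrite !inE.
by case/or3P=> [/eqP->|/eqP->|/IH]; lia.
Qed.

(** Since [matched] only grows with the history, the union of all past decisions equals the latest
    one. *)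
Lemma in_accepted_matching (t : nat) (v : graph sigma) : t <= size s ->
  (v \in accepted matching_strategy sigma t) =
    (index v s \in matched (revealed sigma t)).
Proof.
elim: t => [|t IH] ts; first by rewrite /= /revealed take0 inE.
rewrite [accepted _ _ _]/= !inE IH ?(ltnW ts) // mem_take_arrivals.
have [x tx ix] := take_rcons_index (arrivals_uniq sigma) ts.
rewrite /matching_strategy -/s.
apply/orP/idP => [[|/andP[]] //|vm]; first by rewrite (revealedS tx) => /sub_matched_rcons.
by right; rewrite vm (matched_lt ts vm).
Qed.

(** Edges between old vertices stay covered as [matched] grows. If the newcomer is not matched, all
    its earlier neighbours are already in. *)
Lemma matching_feasible_run (t : nat) (u v : graph sigma) : t <= size s ->
  index u s < t -> index v s < t -> edge u v ->
  (index u s \in matched (revealed sigma t)) ||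
    (index v s \in matched (revealed sigma t)).
Proof.
elim: t u v => [//|t IH] u v ts.
wlog uv : u v / index u s <= index v s.
  move=> W ut vt euv; case: (leqP (index u s) (index v s)) => [/W|/ltnW /W]; first exact.
  by rewrite orbC edge_sym; apply.
move=> ut vt euv; have [x tx ix] := take_rcons_index (arrivals_uniq sigma) ts.
rewrite (revealedS tx).
case: (ltnP (index v s) t) => [vt'|tv].
  have ut' := leq_ltn_trans uv vt'.
  by case/orP: (IH u v (ltnW ts) ut' vt' euv) => /sub_matched_rcons ->; rewrite ?orbT.
have {tx ix}-> : x = v.
  by apply: (index_arrivals_inj); rewrite ix; lia.
have uv' : index u s < index v s.
  rewrite ltn_neqAle uv andbT; apply: contraTneq euv => /index_arrivals_inj->.
  by rewrite edge_irr.
rewrite /matched foldl_rcons; case: matching_stepP => [p _ _ _|allS].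
  by rewrite size_arrival !inE eqxx !orbT.
by rewrite allS ?size_arrival ?nth_arrival // edge_sym.
Qed.

(** A step adds either nothing or both endpoints of an edge. One of these new vertices lies in [C],
    so the factor 2 persists. *)
Lemma accepted_matching_le (C : {set graph sigma}) (t : nat) :
  vertex_cover C -> t <= size s ->
  #|accepted matching_strategy sigma t| <=
    2 * #|accepted matching_strategy sigma t :&: C|.
Proof.
move=> vcC; elim: t => [|t IH] ts; first by rewrite /= cards0.
have [v tv iv] := take_rcons_index (arrivals_uniq sigma) ts.
have {IH} := IH (ltnW ts).
set B := accepted _ _ t; set B' := accepted _ _ t.+1.
have memB w : (w \in B) = (index w s \in matched (revealed sigma t)).
  exact: in_accepted_matching (ltnW ts).
have: forall w, (w \in B') = (index w s \in matched (revealed sigma t.+1)).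
  by move=> w; exact: in_accepted_matching ts.
rewrite (revealedS tv) /matched foldl_rcons.
case: matching_stepP => [p pv ep pS|_] memB' IH; last first.
  by have -> : B' = B by apply/setP => w; rewrite memB' memB.
rewrite size_arrival in pv memB'.
have ps : p < size s by rewrite (ltn_trans pv) // index_mem arrivals_full.
have [u _ iu] := take_rcons_index (arrivals_uniq sigma) ps.
rewrite -{}iu in memB' pv ep pS; rewrite nth_arrival // in ep.
have uB : u \notin B by rewrite memB.
have vB : v \notin B.
  by rewrite memB iv; apply/negP => /(matched_lt (ltnW ts)); rewrite ltnn.
have uv : u != v by apply: contraTneq ep => ->; rewrite edge_irr.
have -> : B' = u |: (v |: B).
  apply/setP => w; rewrite memB' !inE memB.
  by rewrite !(inj_eq index_arrivals_inj).
rewrite !cardsU1 !inE negb_or uv uB vB.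
(* The left side has grown by exactly 2, so a single new vertex in [C] suffices. *)
suff : #|B :&: C| < #|(u |: (v |: B)) :&: C| by lia.
apply: proper_card; rewrite properE setSI; last first.
  by apply/subsetP => w wB; rewrite !inE wB !orbT.
have /orP[vC|uC] : (v \in C) || (u \in C).
  by have /forallP/(_ v)/forallP/(_ u) := vcC; rewrite ep.
  by apply/subsetPn; exists v; rewrite !inE ?eqxx ?vC ?orbT // (negbTE vB).
by apply/subsetPn; exists u; rewrite !inE ?eqxx ?uC // (negbTE uB).
Qed.

End MatchingRun.

Lemma matching_feasible : feasible matching_strategy.
Proof.
move=> sigma t ts u v; rewrite !mem_take_arrivals !in_accepted_matching //.
exact: matching_feasible_run.
Qed.

Definition matching_algorithm := LateAcceptAlgorithm matching_feasible.

Lemma cost_matching (sigma : input) :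
  cost matching_algorithm sigma <= 2 * opt (graph sigma).
Proof.
have [C vcC <-] := opt_cover (graph sigma).
apply: leq_trans (accepted_matching_le vcC (leqnn _)) _.
by rewrite leq_mul2l subset_leq_card ?subsetIr.
Qed.

(** * Initial segments of a graph on the natural numbers *)

Section Segment.

Variable e : rel nat.
Hypotheses (e_sym : symmetric e) (e_irr : irreflexive e).

Let seg_edge (n : nat) : rel 'I_n := fun i j => e i j.

Definition segment_graph (n : nat) : sgraph :=
  @SGraph 'I_n (@seg_edge n) (fun i j => e_sym i j) (fun i => e_irr i).

(** Vertices arrive in increasing order, so each vertex is its own arrival position. *)
Definition segment (n : nat) : input :=
  @Input (segment_graph n) (enum 'I_n) (enum_uniq 'I_n) (mem_enum 'I_n).

(** Free of [n]: every segment with at least [t] vertices reveals this after [t] arrivals. *)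
Definition history (t : nat) : seq (seq bool) :=
  [seq [seq e j i | i <- iota 0 j] | j <- iota 0 t].

(* Whether [d] has accepted position [p] by step [t]; this does not depend on
   how many vertices of the infinite graph are presented later. *)
Definition accepts (d : strategy) (t p : nat) : bool :=
  has (fun k => (p < k) && d (history k) p) (iota 1 t).

Lemma take_enum_ord (n t : nat) : t <= n ->
  [seq val i | i <- take t (enum 'I_n)] = iota 0 t.
Proof. by move=> tn; rewrite map_take val_enum_ord take_iota; congr iota; lia. Qed.

Lemma revealed_segment (n t : nat) : t <= n ->
  revealed (segment n) t = history t.
Proof.
move=> tn; rewrite /history -(take_enum_ord tn) -map_comp.
apply: eq_map => j /=; rewrite -(take_enum_ord (ltnW (ltn_ord j))).
by rewrite -map_comp /arrival /= index_enum_ord.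
Qed.

Lemma in_accepted_segment (d : strategy) (n t : nat) (v : 'I_n) : t <= n ->
  (v \in accepted d (segment n) t) = accepts d t v.
Proof.
elim: t => [|t IH] tn; first by rewrite /= inE.
have iotaS : iota 1 t.+1 = rcons (iota 1 t) t.+1.
  by rewrite -(addn1 t) iotaD cats1 addnC.
rewrite [accepted _ _ _]/= !inE IH ?(ltnW tn) // /accepts iotaS has_rcons orbC.
by rewrite revealed_segment // in_take ?mem_enum // index_enum_ord.
Qed.

Lemma accepts_mono (d : strategy) (t t' p : nat) :
  t <= t' -> accepts d t p -> accepts d t' p.
Proof.
move=> tt' /hasP[k]; rewrite mem_iota => kt dk; apply/hasP; exists k => //.
by rewrite mem_iota; lia.
Qed.

(** Feasibility is used on the segment with exactly [t] vertices; stated through [accepts], the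
    result carries over to all longer segments. *)
Lemma accepts_edge (A : late_accept_algorithm) (t i j : nat) :
  i < t -> j < t -> e i j -> accepts A t i || accepts A t j.
Proof.
move=> it jt eij.
have tt : t <= size (arrivals (segment t)) by rewrite size_enum_ord.
have := @decide_feasible A _ t tt (Ordinal it) (Ordinal jt).
rewrite !mem_take_arrivals /= !index_enum_ord !in_accepted_segment //=.
exact.
Qed.

Lemma cost_segment (A : late_accept_algorithm) (n : nat) :
  cost A (segment n) = \sum_(i < n) accepts A n i.
Proof.
rewrite /cost /= size_enum_ord -sum1_card big_mkcond /=.
by apply: eq_bigr => i _; rewrite in_accepted_segment //; case: accepts.
Qed.

End Segment.

(** * The adversary *)

(** As [f b k] reads only the values of [b] below [k], the equation is a course-of-values
    recursion. *)
Lemma exists_nonanticipative (f : (nat -> bool) -> nat -> bool) :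
  (forall b b' k, (forall i, i < k -> b i = b' i) -> f b k = f b' k) ->
  exists b, forall k, b k = f b k.
Proof.
move=> f_prefix.
(* [bs n] lists the first [n] values of the solution; the default [false] beyond them is never read
   by [f]. *)
pose bs := fix bs n := if n is m.+1 then rcons (bs m) (f (nth false (bs m)) m) else [::].
have size_bs n : size (bs n) = n by elim: n => //= n IH; rewrite size_rcons IH.
have nth_bs n k : k < n -> nth false (bs n) k = nth false (bs k.+1) k.
  elim: n => // n IH; rewrite ltnS leq_eqVlt => /orP[/eqP-> //|kn].
  by rewrite /= nth_rcons size_bs kn IH.
exists (fun k => nth false (bs k.+1) k) => k.
rewrite /= nth_rcons size_bs ltnn eqxx; apply: f_prefix => i ik.
exact: nth_bs.
Qed.

Section Paths.

Variable b : nat -> bool.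

(** Path [k] occupies the positions from [3 * k] to [3 * k + 2]. Its first two vertices are adjacent
    for either bit; the bit only decides which of them the third one joins. *)
Definition middle (k : nat) : nat := 3 * k + ~~ b k.

Definition paths : rel nat := fun i j =>
  [&& i != j, i %/ 3 == j %/ 3 & (i == middle (i %/ 3)) || (j == middle (j %/ 3))].

Lemma paths_sym : symmetric paths.
Proof. by move=> i j; rewrite /paths eq_sym [in X in _ && X]eq_sym [(_ == _) || _]orbC. Qed.

Lemma paths_irr : irreflexive paths.
Proof. by move=> i; rewrite /paths eqxx. Qed.

(** The [n] middle vertices form a cover. *)
Lemma opt_paths (n : nat) : opt (segment_graph paths_sym paths_irr (3 * n)) <= n.
Proof.
have mid_lt (k : 'I_n) : middle k < 3 * n.
  by have := ltn_ord k; rewrite /middle; case: (b k); lia.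
pose C := [set Ordinal (mid_lt k) | k : 'I_n].
have midC (i : 'I_(3 * n)) : i == middle (i %/ 3) :> nat -> i \in C.
  move=> /eqP im; have kn : i %/ 3 < n by have := ltn_ord i; lia.
  by apply/imsetP; exists (Ordinal kn) => //; apply: val_inj.
apply: leq_trans (opt_le (C := C : {set segment_graph _ _ _}) _) _; last first.
  by rewrite -[n in _ <= n]card_ord leq_imset_card.
apply/forallP => i; apply/forallP => j; apply/implyP => /and3P[_ _].
by case/orP=> /midC ->; rewrite ?orbT.
Qed.

End Paths.

(** Before the third vertex of path [k] arrives, the bit [b k] has left no trace in the history. *)
Lemma history_paths_prefix (b b' : nat -> bool) (k t : nat) :
  (forall i, i < k -> b i = b' i) -> t <= 3 * k + 2 ->
  history (paths b) t = history (paths b') t.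
Proof.
move=> bb' tk; apply/eq_in_map => j; rewrite mem_iota => jt.
apply/eq_in_map => i; rewrite mem_iota => ij; rewrite /paths /middle.
case: (j %/ 3 =P i %/ 3) => [E|_]; last by rewrite !andbF.
case: (ltnP (j %/ 3) k) => jk; first by rewrite -E bb'.
(* Here [i] and [j] can only be [3 * k] and [3 * k + 1], adjacent for both bits. *)
by rewrite -E; case: (b _); case: (b' _) => /=; lia.
Qed.

(** The algorithm's answer after [3 * k + 2] arrivals depends only on the bits below [k], so this
    circular-looking choice of [b] is possible. *)
Lemma exists_adversary (A : late_accept_algorithm) :
  exists b, forall k, b k = ~~ accepts (paths b) A (3 * k + 2) (3 * k).
Proof.
apply: exists_nonanticipative => b b' k bb'; congr (~~ _).
apply: eq_in_has => t; rewrite mem_iota => tk.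
by rewrite (@history_paths_prefix b b' k) //; lia.
Qed.

Lemma cost_adversary (A : late_accept_algorithm) (b : nat -> bool) (n : nat) :
  (forall k, b k = ~~ accepts (paths b) A (3 * k + 2) (3 * k)) ->
  2 * n <= cost A (segment (paths_sym b) (paths_irr b) (3 * n)).
Proof.
move=> adv; rewrite cost_segment.
set acc := accepts (paths b) A (3 * n).
suff path_le k : k < n -> 2 <= acc (3 * k) + acc (3 * k + 1) + acc (3 * k + 2).
  rewrite -(big_mkord xpredT (fun i => acc i : nat)).
  have : forall m, m <= n -> 2 * m <= \sum_(0 <= i < 3 * m) acc i.
    elim=> [//|m IH] mn; have := path_le m mn; have := IH (ltnW mn).
    rewrite (_ : 3 * m.+1 = (3 * m).+3); last by lia.
    rewrite !big_nat_recr //= addn1 addn2; lia.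
  exact.
move=> kn.
have mono p : accepts (paths b) A (3 * k + 2) p -> acc p.
  by apply: accepts_mono; lia.
have edge2 i j t : i < t -> j < t -> paths b i j ->
    accepts (paths b) A t i || accepts (paths b) A t j.
  by apply: accepts_edge; [exact: paths_sym | exact: paths_irr].
have d0 : 3 * k %/ 3 = k by lia.
have d1 : (3 * k + 1) %/ 3 = k by lia.
have d2 : (3 * k + 2) %/ 3 = k by lia.
have e01 : paths b (3 * k) (3 * k + 1).
  by rewrite /paths /middle d0 d1; case: (b k); lia.
have h01 : accepts (paths b) A (3 * k + 2) (3 * k) ||
    accepts (paths b) A (3 * k + 2) (3 * k + 1).
  by apply: edge2 e01; lia.
(* In both cases the third vertex is joined to the one of the first two that need not be accepted
   yet, while the other one is accepted. *)
case bk: (b k); move: (adv k); rewrite bk => /esym.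
  move=> /negbTE a0; rewrite a0 /= in h01.
  have e02 : paths b (3 * k) (3 * k + 2).
    by rewrite /paths /middle d0 d2 bk; lia.
  have : acc (3 * k) || acc (3 * k + 2) by apply: edge2 e02; lia.
  by rewrite (mono _ h01) => /orP[->|->]; lia.
move=> /negbFE a0.
have e12 : paths b (3 * k + 1) (3 * k + 2).
  by rewrite /paths /middle d1 d2 bk; lia.
have : acc (3 * k + 1) || acc (3 * k + 2) by apply: edge2 e12; lia.
by rewrite (mono _ a0) => /orP[->|->]; lia.
Qed.

(** * The two bounds on the competitive ratio over the reals *)

Local Open Scope ring_scope.

Theorem theorem11 (R : realType) :
  (exists A : late_accept_algorithm, strictly_competitive A (2 : R)) /\
  (forall c : R, c < 2 -> forall A : late_accept_algorithm, ~ competitive A c).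
Proof.
split.
  exists matching_algorithm => sigma.
  by rewrite addr0 -natrM ler_nat cost_matching.
move=> c c2 A [alpha compA].
have [b adv] := exists_adversary A.
(* Nonnegativity allows the bound on the optimum to be multiplied by the ratio. *)
pose c' := Num.max c 0.
have c'0 : 0 <= c' by rewrite le_max lexx orbT.
have c'2 : 0 < 2 - c' by rewrite subr_gt0 gt_max c2 ltr0n.
have bound n : (2 - c') * n%:R <= alpha.
  have := compA (segment (paths_sym b) (paths_irr b) (3 * n)).
  have := cost_adversary n adv; rewrite -(ler_nat R) natrM.
  have := opt_paths b n; rewrite -(ler_nat R) /=.
  set o := (opt _)%:R => on cost_ge cost_le.
  have : c * o <= c' * o by rewrite ler_wpM2r ?ler0n // le_max lexx.
  have : c' * o <= c' * n%:R by rewrite ler_wpM2l.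
  by lra.
(* This number of paths exceeds [alpha / (2 - c')]. *)
have := bound (Num.truncn (alpha / (2 - c'))).+1.
apply/negP; rewrite -ltNge mulrC -ltr_pdivrMr //.
exact: truncnS_gt.
Qed.
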